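(* Let $u(x,t)$ be the exact solution of the conservative PDE $\frac{\partial u}{\partial t}=\mathcal{J}\frac{\delta\mathcal{G}}{\delta u}$, $u(t_0)=u_0$, with independent invariant functionals $\mathcal{H}_1,\dots,\mathcal{H}_n$, and let $\frac{\delta\mathcal{H}_i}{\delta(\cdot,\cdot)}$ be a fixed discrete variational derivative of $\mathcal{H}_i$ for $i=1,\dots,n$. Let $\psi_h$ be a one-step time-stepping integrator for this PDE. Let $\mathcal{P}(v,w)$ denote the projection operator defined in the context, and consider the projection integrator $$u^{k+1}(x)=u^k(x)+\mathcal{P}\left(u^{k+1}(x),u^k(x)\right)\left(\psi_h(u^k(x))-u^k(x)\right).$$ If the underlying integrator $\psi_h$ is of order $p$, then the projection integrator is of order $p$ as well, in the sense that $$\left\|u(x,t+h)-u(x,t)-\mathcal{P}\left(u(x,t+h),u(x,t)\right)\left(\psi_h(u(x,t))-u(x,t)\right)\right\|=\mathcal{O}(h^{p+1}),$$ where $\|\cdot\|$ is the norm of $L^2(\Omega)$.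
   Context: Setting. $\Omega\subseteq\mathbb{R}^d$, and $\mathcal{F}(\Omega)\subset L^2(\Omega)$ is the (linear) function space in which the solutions $u(\cdot,t)$ lie. $\langle v,w\rangle=\int_\Omega vw\,dx$ is the $L^2(\Omega)$ inner product and $\|\cdot\|$ its norm. The PDE is $\frac{\partial u}{\partial t}=\mathcal{J}\frac{\delta\mathcal{G}}{\delta u}$, $u(t_0)=u_0$, where $\mathcal{J}$ is a skew-adjoint operator and $\mathcal{G}[u]=\int_\Omega G[u]\,dx$, with $G[u]$ depending on $u$ and its $x$-derivatives up to some finite degree. The variational derivative of a functional $\mathcal{G}$ is defined by $\int_\Omega\frac{\delta\mathcal{G}}{\delta u}v\,dx=\frac{d}{d\epsilon}\big|_{\epsilon=0}\mathcal{G}[u+\epsilon v]$ for all sufficiently smooth $v$. Standing assumptions: the solution has sufficient regularity, and the boundary conditions are such that boundary terms vanish in integration by parts (e.g. periodic or zero Dirichlet conditions). Invariants. The PDE possesses $n$ independent invariant functionals $\mathcal{H}_i[u]=\int_\Omega H_i[u]\,dx$, $i=1,\dots,n$, i.e. $\mathcal{H}_i[u(\cdot,t)]$ is constant in $t$ along solutions. Discrete variational derivative. A discrete variational derivative of a functional $\mathcal{H}$ assigns to any $u,v\in\mathcal{F}(\Omega)$ a function $\frac{\delta\mathcal{H}}{\delta(u,v)}\in\mathcal{F}(\Omega)$ such that $\mathcal{H}[u]-\mathcal{H}[v]=\left\langle\frac{\delta\mathcal{H}}{\delta(u,v)},u-v\right\rangle$ for $u\neq v$, and $\frac{\delta\mathcal{H}}{\delta(u,u)}=\frac{\delta\mathcal{H}}{\delta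 u}$. Projection operator. For $v,w\in\mathcal{F}(\Omega)$ let $Y(v,w)=\mathrm{span}\left\{\frac{\delta\mathcal{H}_1}{\delta(v,w)},\dots,\frac{\delta\mathcal{H}_n}{\delta(v,w)}\right\}$ and let $\{w^1(x),\dots,w^n(x)\}$ be an orthonormal basis of $Y(v,w)$ with respect to $\langle\cdot,\cdot\rangle$ (such a basis of $n$ elements is assumed to exist). Then $\mathcal{P}(v,w)z=z-\sum_{i=1}^n\langle z,w^i\rangle w^i$. Order. $\psi_h$ (with step size $h$) is of order $p$ if $\|u(x,t+h)-\psi_h(u(x,t))\|=\mathcal{O}(h^{p+1})$ as $h\to0$ for the exact solution $u$. *)

(* Defs.v *)
From HB Require Import structures.
From mathcomp Require Import all_boot all_order all_algebra.
From mathcomp Require Import all_classical all_reals all_analysis.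

Set Implicit Arguments.
Unset Strict Implicit.
Unset Printing Implicit Defensive.

Import Order.TTheory GRing.Theory Num.Theory.
Import numFieldNormedType.Exports.

Local Open Scope classical_set_scope.
Local Open Scope ring_scope.

(* R^d is the type 'rV[R]_d with the sigma-algebra generated by the coordinates *)
(* (the Borel one), following the library's construction for n.-tuple T.       *)
Definition rV_display : measure_display.
Proof. exact: default_measure_display. Qed.

Section measurable_rV.
Variables (R : realType) (n : nat).

Let coors : 'I_n -> 'rV[R]_n -> measurableTypeR R := fun i x => x ord0 i.

Let rV_set0 : g_sigma_preimage coors set0.
Proof. exact: sigma_algebra0. Qed.

Let rV_setC A : g_sigma_preimage coors A -> g_sigma_preimage coors (~` A).
Proof. exact: sigma_algebraC. Qed.

Let rV_bigcup (F : _^nat) : (forall i, g_sigma_preimage coors (F i)) ->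
  g_sigma_preimage coors (\bigcup_i (F i)).
Proof. exact: sigma_algebra_bigcup. Qed.

HB.instance Definition _ := @isMeasurable.Build rV_display
  'rV[R]_n (g_sigma_preimage coors) rV_set0 rV_setC rV_bigcup.

Lemma measurable_coor (i : 'I_n) :
  measurable_fun [set: 'rV[R]_n] (coors i).
Proof.
move=> _ Y mY; rewrite setTI; apply: sub_sigma_algebra => /=.
rewrite -bigcup_seq/=; exists i => /=; first by rewrite mem_index_enum.
by exists Y => //; rewrite setTI.
Qed.

Lemma measurable_fun_rV d1 (T1 : measurableType d1) (f : T1 -> 'rV[R]_n) :
  (forall i, measurable_fun [set: T1] (coors i \o f)) ->
  measurable_fun [set: T1] f.
Proof.
move=> mf.
suff : g_sigma_preimage (fun i => coors i \o f) `<=` measurable.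
  rewrite g_sigma_preimage_comp => mfS _ A mA.
  by apply: mfS; exists A.
apply: smallest_sub; first exact: sigma_algebra_measurable.
rewrite -bigcup_seq => A [i _] [B mB <-]; exact: mf.
Qed.

End measurable_rV.

Section lebesgue_rV.
Variable R : realType.

Definition rV_cons n (p : measurableTypeR R * 'rV[R]_n) : 'rV[R]_n.+1 :=
  \row_i (if unlift ord0 i is Some j then p.2 ord0 j else p.1).

Lemma measurable_rV_cons n : measurable_fun [set: _] (@rV_cons n).
Proof.
apply: measurable_fun_rV => i.
have [j ->|->] := unliftP ord0 i; last first.
  rewrite (_ : _ \o _ = fst); first exact: measurable_fst.
  by apply/funext => p /=; rewrite mxE unlift_none.
rewrite (_ : _ \o _ = (fun x : 'rV[R]_n => x ord0 j) \o snd).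
  by apply: measurableT_comp => //; exact: measurable_coor.
by apply/funext => p /=; rewrite mxE liftK.
Qed.

Section step.
Variables (n : nat) (m : {sigma_finite_measure set 'rV[R]_n -> \bar R}).

Definition lebesgue_rV_step : set 'rV[R]_n.+1 -> \bar R :=
  pushforward (lebesgue_measure \x m)%E (@rV_cons n).

Let measurable_preim A : measurable A -> measurable (@rV_cons n @^-1` A).
Proof. by move=> mA; rewrite -[X in measurable X]setTI; exact: measurable_rV_cons. Qed.

Let step0 : lebesgue_rV_step set0 = 0%E.
Proof. by rewrite /lebesgue_rV_step /pushforward preimage_set0 measure0. Qed.

Let step_ge0 A : (0 <= lebesgue_rV_step A)%E.
Proof. by rewrite /lebesgue_rV_step /pushforward; exact: measure_ge0. Qed.

Let step_sigma_additive : semi_sigma_additive lebesgue_rV_step.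
Proof.
move=> F mF tF mUF; rewrite /lebesgue_rV_step /pushforward preimage_bigcup.
apply: measure_semi_sigma_additive.
- by move=> k; exact: measurable_preim.
- apply/trivIsetP => /= i j _ _ ij; rewrite -preimage_setI.
  by move/trivIsetP : tF => /(_ _ _ _ _ ij) ->//; rewrite preimage_set0.
- by rewrite -preimage_bigcup; exact: measurable_preim.
Qed.

HB.instance Definition _ := isMeasure.Build _ _ _ lebesgue_rV_step
  step0 step_ge0 step_sigma_additive.

Lemma measurable_rV_uncons :
  measurable_fun [set: 'rV[R]_n.+1]
    (fun x => (x ord0 ord0, \row_j x ord0 (lift ord0 j)) : measurableTypeR R * 'rV[R]_n).
Proof.
apply/measurable_fun_pairP; split; first exact: measurable_coor.
apply: measurable_fun_rV => j.
rewrite (_ : _ \o _ = fun x : 'rV[R]_n.+1 => x ord0 (lift ord0 j)).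
  exact: measurable_coor.
by apply/funext => x /=; rewrite mxE.
Qed.

Let step_sigma_finite : sigma_finite setT lebesgue_rV_step.
Proof.
pose mu1 : {sigma_finite_measure set (measurableTypeR R) -> \bar R} :=
  @lebesgue_measure R.
have /sigma_finiteP[F [TF ndF Foo]] := sigma_finiteT mu1.
have /sigma_finiteP[G [TG ndG Goo]] := sigma_finiteT m.
pose uncons (x : 'rV[R]_n.+1) : measurableTypeR R * 'rV[R]_n :=
  (x ord0 ord0, \row_j x ord0 (lift ord0 j)).
exists (fun k => uncons @^-1` (F k `*` G k)).
  apply/seteqP; split => // x _.
  have [k _ Fk] : (\bigcup_k F k) (uncons x).1 by rewrite -TF.
  have [l _ Gl] : (\bigcup_k G k) (uncons x).2 by rewrite -TG.
  exists (maxn k l) => //; split.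
    by move: Fk; exact/subsetPset/ndF/leq_maxl.
  by move: Gl; exact/subsetPset/ndG/leq_maxr.
move=> k; have [mF Fk] := Foo k; have [mG Gk] := Goo k; split.
  rewrite -[X in measurable X]setTI; apply: measurable_rV_uncons => //.
  exact: measurableX.
rewrite /lebesgue_rV_step /pushforward -comp_preimage.
rewrite (_ : _ \o _ = id).
  rewrite preimage_id (product_measure1E mu1 m)// lte_mul_pinfty//.
  by rewrite ge0_fin_numE.
apply/funext => -[a v] /=; rewrite /uncons mxE unlift_none; congr pair.
by apply/rowP => j; rewrite !mxE liftK.
Qed.

HB.instance Definition _ := @Measure_isSigmaFinite.Build _ _ _ lebesgue_rV_step
  step_sigma_finite.

End step.

(* The n-fold product of lebesgue_measure; lebesgue_rV_box below computes it on *)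
(* boxes.                                                                      *)
Fixpoint lebesgue_rV n : {sigma_finite_measure set 'rV[R]_n -> \bar R} :=
  match n return {sigma_finite_measure set 'rV[R]_n -> \bar R} with
  | 0 => dirac (0 : 'rV[R]_0)
  | k.+1 => lebesgue_rV_step (lebesgue_rV k)
  end.

End lebesgue_rV.

Lemma lebesgue_rV_box (R : realType) n (a b : 'rV[R]_n) :
  (forall i, a ord0 i <= b ord0 i) ->
  lebesgue_rV R n [set x | forall i, x ord0 i \in `]a ord0 i, b ord0 i]] =
  (\prod_i (b ord0 i - a ord0 i))%:E.
Proof.
elim: n a b => [|n IH] a b ab.
  by rewrite big_ord0 /= diracE mem_set// => -[].
rewrite big_ord_recl /= /lebesgue_rV_step /pushforward.
pose a' := \row_j a ord0 (lift ord0 j) : 'rV[R]_n.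
pose b' := \row_j b ord0 (lift ord0 j) : 'rV[R]_n.
set B := [set x : 'rV[R]_n | forall i, x ord0 i \in `]a' ord0 i, b' ord0 i]].
rewrite (_ : _ @^-1` _ = `]a ord0 ord0, b ord0 ord0] `*` B).
  have mB : measurable B.
    rewrite (_ : B = \bigcap_(i in [set: 'I_n])
      ((fun x : 'rV[R]_n => x ord0 i) @^-1` `]a' ord0 i, b' ord0 i])).
      apply: fin_bigcap_measurable => // i _.
      by rewrite -[X in measurable X]setTI; apply: measurable_coor => //.
    apply/seteqP; split => x /= Bx i; first by move=> _; exact: Bx.
    exact: Bx.
  rewrite product_measure1E//= lebesgue_measure_itv/= lte_fin.
  rewrite IH; last by move=> i; rewrite !mxE.
  rewrite (eq_bigr (fun i => b ord0 (lift ord0 i) - a ord0 (lift ord0 i))); last first.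
    by move=> i _; rewrite !mxE.
  case: ltP => [_|ba]; first by rewrite -EFinB -EFinM.
  have -> : b ord0 ord0 - a ord0 ord0 = 0.
    by apply/eqP; rewrite subr_eq0 eq_le ba ab.
  by rewrite mul0e mul0r.
apply/seteqP; split => -[x v] /=.
  move=> H; split => [|i]; first by have := H ord0; rewrite mxE unlift_none.
  by have := H (lift ord0 i); rewrite !mxE liftK.
move=> [Hx Hv] i; rewrite mxE; have [j ->|->] := unliftP ord0 i => //.
by have := Hv j; rewrite !mxE.
Qed.

Section setting.
Context {R : realType} {d : nat}.
Local Notation V := ('rV[R]_d -> R).
Local Notation mu := (lebesgue_rV R d).

Section L2.
Variable Omega : set 'rV[R]_d.

(* Elements of L^2(Omega) are represented by functions on R^d: only their      *)
(* restriction to Omega matters, and equality in L^2(Omega) is almost          *)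
(* everywhere equality on Omega.                                               *)
Definition L2 : set V := [set f | f \_ Omega \in Lfun mu 2%:E].

Definition L2inner (v w : V) : R := \int[mu]_(x in Omega) (v x * w x).

Definition L2norm (v : V) : R := Num.sqrt (L2inner v v).

Definition L2_subspace (F : set V) : Prop :=
  [/\ F `<=` L2, F 0 & forall (a : R) v w, F v -> F w -> F (a *: v + w)].

(* The span of f_0, ..., f_(n-1) in L^2(Omega), hence closed under a.e.        *)
(* equality on Omega.                                                          *)
Definition L2span n (f : 'I_n -> V) : set V :=
  [set g | L2 g /\
     exists c : 'I_n -> R, (g = \sum_i c i *: f i %[ae mu in Omega])].

Definition orthonormal_basis n (Y : set V) (w : 'I_n -> V) : Prop :=
  [/\ forall i, Y (w i),
      forall i j, L2inner (w i) (w j) = (i == j)%:R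
    & L2span w = Y].

Definition projection n (w : 'I_n -> V) (z : V) : V :=
  z - \sum_i L2inner z (w i) *: w i.

(* J is an operator on L^2(Omega) with domain D, given on representatives;     *)
(* skew-adjointness is the identity <J v, w> = - <v, J w> obtained from        *)
(* integration by parts without boundary terms.                                *)
Definition skew_adjoint (D : set V) (J : V -> V) : Prop :=
  [/\ L2_subspace D,
      forall v, D v -> L2 (J v),
      forall v w, D v -> D w ->
        v = w %[ae mu in Omega] -> J v = J w %[ae mu in Omega],
      forall (a : R) v w, D v -> D w ->
        J (a *: v + w) = a *: J v + J w %[ae mu in Omega]
    & forall v w, D v -> D w -> L2inner (J v) w = - L2inner v (J w)].

End L2.

(* The iterated partial derivative along the coordinate directions in s; the   *)
(* empty sequence gives f itself.                                              *)
Definition pderiv (s : seq 'I_d) (f : V) : V :=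
  foldr (fun i (g : V) x => 'D_(delta_mx ord0 i) g x) f s.

Definition class_C (m : nat) (Omega : set 'rV[R]_d) (f : V) : Prop :=
  forall (s : seq 'I_d) x, (size s <= m)%N -> Omega° x ->
    {for x, continuous (pderiv s f)} /\
    ((size s < m)%N -> forall i, derivable (pderiv s f) x (delta_mx ord0 i)).

(* A function of u and of its partial derivatives up to order jet_order.       *)
Record density := Density {
  jet_order : nat ;
  integrand : (jet_order.-bseq 'I_d -> R) -> R }.

Definition density_at (G : density) (u : V) : V :=
  fun x => integrand (fun s : (jet_order G).-bseq 'I_d => pderiv s u x).

Definition integral_functional (Omega : set 'rV[R]_d) (G : density) (u : V) : R :=
  \int[mu]_(x in Omega) density_at G u x.

Section pde.
Variables (Omega : set 'rV[R]_d) (F : set V).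

Definition functional_on (G : density) : Prop :=
  forall v, F v -> class_C (jet_order G) Omega v /\
    mu.-integrable Omega (EFin \o density_at G v).

(* The test functions are the elements of F (they carry the boundary           *)
(* conditions) of class C^m, for some sufficiently large m.                    *)
Definition variational_derivative (G : density) (u g : V) : Prop :=
  exists m : nat, forall v, F v -> class_C m Omega v ->
    is_derive (0 : R) 1 (fun e : R => integral_functional Omega G (u + e *: v))
      (L2inner Omega g v).

(* u <> v is read in L^2(Omega); the variational derivative, being unique only *)
(* up to null sets, is a relation, so that the diagonal condition says that    *)
(* dH u u is one.                                                              *)
Definition discrete_variational_derivative (H : density) (dH : V -> V -> V) :
    Prop :=
  [/\ forall u v, F u -> F v -> F (dH u v),
      forall u v, F u -> F v -> ~ (u = v %[ae mu in Omega]) ->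
        integral_functional Omega H u - integral_functional Omega H v =
        L2inner Omega (dH u v) (u - v)
    & forall u, F u -> variational_derivative H u (dH u u)].

(* u solves du/dt = J (delta G / delta u) on the time interval [t0, T[; the    *)
(* time derivative is one-sided at t0.                                         *)
Definition solves_pde (D : set V) (J : V -> V) (G : density) (t0 T : R)
    (u : R -> V) : Prop :=
  forall t, t \in `[t0, T[ -> F (u t) /\
    exists g, [/\ D g, variational_derivative G (u t) g
      & forall x, Omega x ->
          (s - t)^-1 * (u s x - u t x)
            @[s --> within [set` `[t0, T[] t^'] --> J g x].

Definition solves_ivp D J G (t0 T : R) (u0 : V) (u : R -> V) : Prop :=
  solves_pde D J G t0 T u /\ {in Omega, u t0 =1 u0}.

Definition invariant_functional D J G (H : density) : Prop :=
  forall (t0 T : R) (u : R -> V), solves_pde D J G t0 T u ->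
  forall s t, s \in `[t0, T[ -> t \in `[t0, T[ ->
    integral_functional Omega H (u s) = integral_functional Omega H (u t).

(* psi h is the one-step map with step size h > 0.                             *)
Definition order_along (psi : R -> V -> V) (t0 T : R) (u : R -> V) (p : nat) :
    Prop :=
  forall t, t \in `[t0, T[ ->
    (fun h : R => L2norm Omega (u (t + h) - psi h (u t)))
      =O_ (0^'+) (fun h : R => h ^+ p.+1).

End pde.
End setting.

Arguments density : clear implicits.

(* Main.v *)
Require Import Defs.
From HB Require Import structures.
From mathcomp Require Import all_boot all_order all_algebra.
From mathcomp Require Import all_classical all_reals all_analysis.

Set Implicit Arguments.
Unset Strict Implicit.
Unset Printing Implicit Defensive.

Import Order.TTheory GRing.Theory Num.Theory.
Import numFieldNormedType.Exports.

Local Open Scope classical_set_scope.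
Local Open Scope ring_scope.

(** The two ingredients are a Pythagorean and a conservation argument.  Write
a = u (t + h), b = u t, y = psi h b and let P be the projection onto the
orthogonal complement of the span of the discrete variational derivatives of
the invariants at (a, b), a span with orthonormal basis w.  Each invariant takes
the same value at a and at b, so the discrete chain rule
   H_i a - H_i b = <dH_i (a, b), a - b>
says that a - b is orthogonal to that span ([conserved_diff_orthogonal]), that
is, P (a - b) = a - b.
By linearity of P the local error of the projection method is therefore
the projection of the local error of psi,
   a - b - P (y - b) = P (a - y)   ([projection_of_orthogonal_diff]),
and an orthogonal projection does not increase the L^2 norm
([L2norm_projection_le]).  Hence the new local error is bounded, with constant
1, by the one of psi, for every step h so small that t + h is still in the time
interval of the solution and that the orthonormal basis exists.

Functions are only square integrable representatives of classes in L^2(Omega),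
so the inner product is bilinear only on [L2] and each use of bilinearity
carries membership in [L2]. *)

(** * The pre-Hilbert structure of square integrable functions *)

Section L2_theory.
Context {R : realType} {d : nat} {Omega : set 'rV[R]_d}.
Context (mOmega : measurable Omega).
Local Notation V := ('rV[R]_d -> R).
Local Notation mu := (lebesgue_rV R d).
Local Notation L2 := (L2 Omega).
Local Notation inner := (L2inner Omega).
Implicit Types (f g h : V) (a : R).

Lemma L2_linear a f g : L2 f -> L2 g -> L2 (a *: f + g).
Proof.
rewrite /Defs.L2 /= => Lf Lg.
have -> : (a *: f + g) \_ Omega = a *: (f \_ Omega) + g \_ Omega.
  apply/funext => x; rewrite !fctE !patchE.
  by case: ifP => // _; rewrite scaler0 addr0.
have le12 : (1 <= 2%:E :> \bar R)%E by rewrite lee_fin ler1n.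
by have [_] := Lfun_submod_closed mu le12; exact.
Qed.

Lemma L2_0 : L2 0.
Proof.
rewrite /Defs.L2 /=.
have -> : (0 : V) \_ Omega = 0.
  by apply/funext => x; rewrite !patchE; case: ifP.
have le12 : (1 <= 2%:E :> \bar R)%E by rewrite lee_fin ler1n.
by have [] := Lfun_submod_closed mu le12.
Qed.

Lemma L2D f g : L2 f -> L2 g -> L2 (f + g).
Proof. by move=> Lf Lg; rewrite -[f]scale1r; exact: L2_linear. Qed.

Lemma L2Z a f : L2 f -> L2 (a *: f).
Proof. by move=> Lf; rewrite -[_ *: _]addr0; exact: (L2_linear _ Lf L2_0). Qed.

Lemma L2B f g : L2 f -> L2 g -> L2 (f - g).
Proof. by move=> Lf Lg; rewrite -scaleN1r; exact: L2D Lf (L2Z _ Lg). Qed.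

Lemma L2_lincomb n (c : 'I_n -> R) (f : 'I_n -> V) :
  (forall i, L2 (f i)) -> L2 (\sum_i c i *: f i).
Proof.
by move=> Lf; apply: big_ind => [|? ?|i _]; [exact: L2_0|exact: L2D|exact: L2Z].
Qed.

Lemma integrable_L2_mul f g : L2 f -> L2 g ->
  mu.-integrable Omega (EFin \o (fun x => f x * g x)).
Proof.
rewrite /Defs.L2 /= => Lf Lg; apply/(integrable_mkcond _ mOmega).
rewrite restrict_EFin.
have /Lfun1_integrable := Lfun2_mul_Lfun1 Lf Lg; congr (_.-integrable _ _).
apply/funext => x /=; congr EFin; rewrite !patchE.
by case: ifP => // _; rewrite mul0r.
Qed.

Lemma L2innerC f g : inner f g = inner g f.
Proof. by rewrite /L2inner; apply: eq_Rintegral => x _; rewrite mulrC. Qed.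

Lemma L2inner_linearl h a f g : L2 h -> L2 f -> L2 g ->
  inner (a *: f + g) h = a * inner f h + inner g h.
Proof.
move=> Lh Lf Lg; rewrite /L2inner -RintegralZl//; last exact: integrable_L2_mul.
rewrite -RintegralD//; last exact: integrable_L2_mul.
  apply: eq_Rintegral => x _.
  by rewrite !fctE mulrDl -mulrA.
have := integrable_L2_mul (L2Z a Lf) Lh.
congr (_.-integrable _ _); apply/funext => x /=; congr EFin.
by rewrite !fctE -mulrA.
Qed.

Lemma L2inner0l h : inner 0 h = 0.
Proof.
rewrite /L2inner (@eq_Rintegral _ _ _ mu Omega (fun=> 0)).
  by rewrite Rintegral_cst// mul0r.
by move=> x _; rewrite mul0r.
Qed.

Lemma L2innerDl h f g : L2 h -> L2 f -> L2 g ->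
  inner (f + g) h = inner f h + inner g h.
Proof.
by move=> Lh Lf Lg; rewrite -[f in LHS]scale1r L2inner_linearl// mul1r.
Qed.

Lemma L2innerZl h a f : L2 h -> L2 f -> inner (a *: f) h = a * inner f h.
Proof.
move=> Lh Lf; rewrite -[_ *: _]addr0 L2inner_linearl//; last exact: L2_0.
by rewrite L2inner0l addr0.
Qed.

Lemma L2innerBl h f g : L2 h -> L2 f -> L2 g ->
  inner (f - g) h = inner f h - inner g h.
Proof.
move=> Lh Lf Lg; rewrite -scaleN1r L2innerDl//; last exact: L2Z.
by rewrite L2innerZl// mulN1r.
Qed.

Lemma L2inner_lincombl n h (c : 'I_n -> R) (f : 'I_n -> V) :
  L2 h -> (forall i, L2 (f i)) ->
  inner (\sum_i c i *: f i) h = \sum_i c i * inner (f i) h.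
Proof.
move=> Lh Lf.
(* The induction carries membership, without which additivity fails. *)
suff [] : L2 (\sum_i c i *: f i) /\
  inner (\sum_i c i *: f i) h = \sum_i c i * inner (f i) h by [].
apply: (big_ind2 (fun s r => L2 s /\ inner s h = r)).
- by split; [exact: L2_0 | exact: L2inner0l].
- by move=> s _ s' _ [Ls <-] [Ls' <-]; split; [exact: L2D | rewrite L2innerDl].
- by move=> i _; split; [exact: L2Z | rewrite L2innerZl].
Qed.

(** An element of a span is a linear combination of the generators only up to a
null set; this lemma lets such an almost everywhere identity be rewritten inside
an inner product. *)
Lemma L2inner_ae_eql h f g : L2 h -> L2 f -> L2 g ->
  f = g %[ae mu in Omega] -> inner f h = inner g h.
Proof.
move=> Lh Lf Lg fg; rewrite /L2inner /Rintegral; congr fine.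
apply: ae_eq_integral => //.
- by case/integrableP: (integrable_L2_mul Lf Lh).
- by case/integrableP: (integrable_L2_mul Lg Lh).
- by apply: filterS fg => x fg Ox /=; rewrite fg.
Qed.

(** * Orthogonal projections *)

Lemma L2span_L2 n (f : 'I_n -> V) g : L2span Omega f g -> L2 g.
Proof. by case. Qed.

Lemma L2span_orthogonal n (f : 'I_n -> V) h g :
  L2 h -> (forall i, L2 (f i)) -> (forall i, inner (f i) h = 0) ->
  L2span Omega f g -> inner g h = 0.
Proof.
move=> Lh Lf fh [Lg [c gE]].
rewrite (L2inner_ae_eql Lh Lg (L2_lincomb c Lf) gE) L2inner_lincombl//.
by apply: big1 => i _; rewrite fh mulr0.
Qed.

(** Bessel's inequality: for an orthonormal family w,
|P z|^2 = |z|^2 - sum_i <z, w i>^2. *)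
Lemma L2norm_projection_le n (Y : set V) (w : 'I_n -> V) z :
  (forall i, L2 (w i)) -> orthonormal_basis Omega Y w -> L2 z ->
  L2norm Omega (projection Omega w z) <= L2norm Omega z.
Proof.
move=> Lw [_ ortho _] Lz; rewrite /L2norm ler_wsqrtr//.
pose s := \sum_i inner z (w i) *: w i.
have Ls : L2 s by exact: L2_lincomb.
rewrite /projection -/s.
have szE : inner s z = \sum_i inner z (w i) ^+ 2.
  rewrite L2inner_lincombl//; apply: eq_bigr => i _.
  by rewrite [inner (w i) z]L2innerC expr2.
have swE i : inner s (w i) = inner z (w i).
  rewrite L2inner_lincombl// (bigD1 i)//= ortho eqxx mulr1 big1 ?addr0//.
  by move=> j ji; rewrite ortho (negbTE ji) mulr0.
have ssE : inner s s = \sum_i inner z (w i) ^+ 2.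
  rewrite {1}/s L2inner_lincombl//; apply: eq_bigr => i _.
  by rewrite [inner (w i) s]L2innerC swE expr2.
have Lzs : L2 (z - s) by exact: L2B.
rewrite L2innerBl// ![inner _ (z - s)]L2innerC !L2innerBl//.
rewrite ssE [inner z s]L2innerC szE subrr subr0 gerBl.
by apply: sumr_ge0 => i _; exact: sqr_ge0.
Qed.

(** The projection is linear and fixes v, which is orthogonal to its kernel. *)
Lemma projection_of_orthogonal_diff n (w : 'I_n -> V) v z :
  (forall i, L2 (w i)) -> L2 v -> L2 z -> (forall i, inner v (w i) = 0) ->
  v - projection Omega w z = projection Omega w (v - z).
Proof.
move=> Lw Lv Lz vw; rewrite /projection opprB addrA addrAC; congr (_ + _).
rewrite -sumrN; apply: eq_bigr => i _.
by rewrite L2innerBl// vw sub0r scaleNr opprK.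
Qed.

(** * Conservation and order *)

(** The discrete chain rule is only available when a and b differ in L^2(Omega);
otherwise a - b is null and orthogonal to everything. *)
Lemma conserved_diff_orthogonal (F : set V) n (H : 'I_n -> density R d)
    (dH : 'I_n -> V -> V -> V) (a b g : V) :
  L2_subspace Omega F ->
  (forall i, discrete_variational_derivative Omega F (H i) (dH i)) ->
  F a -> F b ->
  (forall i, integral_functional Omega (H i) a =
             integral_functional Omega (H i) b) ->
  L2span Omega (fun i => dH i a b) g -> inner (a - b) g = 0.
Proof.
move=> [FL2 _ _] hdH Fa Fb Hab Yg; rewrite L2innerC.
have [La Lb] := (FL2 _ Fa, FL2 _ Fb).
apply: L2span_orthogonal Yg => [|i|i]; first exact: L2B.
  by have [+ _ _] := hdH i => dHF; exact/FL2/dHF.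
have [dHF chain _] := hdH i; have LdH := FL2 _ (dHF _ _ Fa Fb).
have [ab|ab] := pselect (a = b %[ae mu in Omega]).
  by rewrite L2innerC L2innerBl// (L2inner_ae_eql LdH La Lb ab) subrr.
by rewrite -chain// Hab subrr.
Qed.

End L2_theory.

Theorem theorem3p1 (R : realType) (d n p : nat) (Omega : set 'rV[R]_d)
    (F : set ('rV[R]_d -> R))
    (D : set ('rV[R]_d -> R)) (J : ('rV[R]_d -> R) -> ('rV[R]_d -> R))
    (G : density R d) (H : 'I_n -> density R d)
    (dH : 'I_n -> ('rV[R]_d -> R) -> ('rV[R]_d -> R) -> ('rV[R]_d -> R))
    (w : ('rV[R]_d -> R) -> ('rV[R]_d -> R) -> 'I_n -> ('rV[R]_d -> R))
    (psi : R -> ('rV[R]_d -> R) -> ('rV[R]_d -> R))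
    (t0 T : R) (u0 : 'rV[R]_d -> R) (u : R -> 'rV[R]_d -> R)
    (mOmega : measurable Omega)
    (hF : L2_subspace Omega F)
    (hJ : skew_adjoint Omega D J)
    (hG : functional_on Omega F G)
    (hH : forall i, functional_on Omega F (H i))
    (H_inv : forall i, invariant_functional Omega F D J G (H i))
    (hdH : forall i, discrete_variational_derivative Omega F (H i) (dH i))
    (hpsi : forall h v, 0 < h -> F v -> F (psi h v))
    (hu : solves_ivp Omega F D J G t0 T u0 u)
    (hw : forall t, t \in `[t0, T[ -> \forall h \near 0^'+,
       orthonormal_basis Omega
         (L2span Omega (fun i => dH i (u (t + h)) (u t)))
         (w (u (t + h)) (u t)))
    (psi_order : order_along Omega psi t0 T u p) :
  forall t, t \in `[t0, T[ ->
    (fun h : R => L2norm Omega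
       (u (t + h) - u t
        - projection Omega (w (u (t + h)) (u t)) (psi h (u t) - u t)))
      =O_ (0^'+) (fun h : R => h ^+ p.+1).
Proof.
move=> t tI; have [FL2 _ _] := hF.
have [hpde _] := hu; have Fu s : s \in `[t0, T[ -> F (u s) by case/hpde.
have [k k_gt0 psi_k] := (eqO_exP _ _ _).1 (psi_order t tI).
apply/eqO_exP; exists k => //.
have t_lt_T : 0 < T - t by move: tI; rewrite in_itv /= subr_gt0 => /andP[].
near=> h.
have h_gt0 : 0 < h by near: h; exact: nbhs_right_gt.
have thI : t + h \in `[t0, T[.
  move: (tI); rewrite !in_itv /= => /andP[t0t _].
  rewrite (le_trans t0t) ?lerDl ?(ltW h_gt0)//= addrC -ltrBrDr.
  by near: h; exact: nbhs_right_lt.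
have basis : orthonormal_basis Omega
    (L2span Omega (fun i => dH i (u (t + h)) (u t))) (w (u (t + h)) (u t)).
  by near: h; exact: hw.
have psi_le : `|L2norm Omega (u (t + h) - psi h (u t))| <= k * `|h ^+ p.+1|.
  by near: h; exact: psi_k.
have [Fb Fa] := (Fu _ tI, Fu _ thI); have Fy := hpsi _ _ h_gt0 Fb.
have [La [Lb Ly]] := (FL2 _ Fa, (FL2 _ Fb, FL2 _ Fy)).
have [Yw _ _] := basis; have Lw i := L2span_L2 (Yw i).
rewrite (projection_of_orthogonal_diff mOmega)//; first last.
- move=> i; apply: (conserved_diff_orthogonal mOmega hF hdH) (Yw i) => // j.
  exact: H_inv hpde _ _ thI tI.
- exact: L2B.
- exact: L2B.
rewrite opprB addrA subrK.
apply: le_trans psi_le; rewrite !ger0_norm ?sqrtr_ge0//.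
by apply: (L2norm_projection_le mOmega Lw basis); exact: L2B.
Unshelve. all: by end_near. Qed.
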